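(* Let $G$ be a finite group. If the graph $\Gamma(G|G')$ is disconnected and $|\mathrm{cod}(G|G')|=2$, then the graph $\Gamma(G)$ is disconnected.
   Context: $\mathrm{Irr}(G)$ is the set of irreducible complex characters of the finite group $G$, and $G'$ is the derived subgroup. The codegree of $\chi\in\mathrm{Irr}(G)$ is $\mathrm{cod}(\chi)=|G:\ker\chi|/\chi(1)$. For $N\trianglelefteq G$, $\mathrm{Irr}(G|N)$ is the set of $\chi\in\mathrm{Irr}(G)$ whose kernel does not contain $N$, and $\mathrm{cod}(G|N)=\{\mathrm{cod}(\chi)\mid\chi\in\mathrm{Irr}(G|N)\}$. The graph $\Gamma(G|N)$ has as vertices the primes dividing some element of $\mathrm{cod}(G|N)$, and two distinct primes $p,q$ are adjacent if $pq\mid\mathrm{cod}(\chi)$ for some $\chi\in\mathrm{Irr}(G|N)$. One writes $\Gamma(G)=\Gamma(G|G)$. *)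

(* Defs.v *)
From HB Require Import structures.
From mathcomp Require Import all_boot all_order all_algebra.
From mathcomp Require Import all_fingroup all_solvable all_field all_character.

Set Implicit Arguments.
Unset Strict Implicit.
Unset Printing Implicit Defensive.

Import Order.TTheory GRing.Theory Num.Theory.

Local Open Scope group_scope.
Local Open Scope ring_scope.

(* For an irreducible chi, chi 1 is a natural number dividing #|G : cfker chi|,
   so neither the truncation nor the natural-number division loses anything:
   see codegreeE. *)
Definition codegree (gT : finGroupType) (G : {group gT}) (chi : 'CF(G)) : nat :=
  (#|G : cfker chi| %/ Num.truncn (chi 1%g))%N.

Lemma codegreeE (gT : finGroupType) (G : {group gT}) (i : Iirr G) :
  (codegree 'chi_i)%:R = #|G : cfker 'chi_i|%:R / 'chi_i 1%g :> algC.
Proof.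
have kG := cfker_normal 'chi_i.
have Di : 'chi_(quo_Iirr (cfker 'chi_i) i) 1%g = 'chi_i 1%g.
  by rewrite quo_IirrE // cfQuo1.
have := dvd_irr1_cardG (quo_Iirr (cfker 'chi_i) i).
rewrite Di card_quotient ?cfker_norm // /codegree irr1_degree natrK.
rewrite dvdC_nat => dv; rewrite natr_div // unitfE pnatr_eq0.
by rewrite -lt0n irr_degree_gt0.
Qed.

Definition Irr_over (gT : finGroupType) (G : {group gT}) (N : {set gT}) :
    {set Iirr G} :=
  [set i : Iirr G | ~~ (N \subset cfker 'chi_i)].

Definition cod (gT : finGroupType) (G : {group gT}) (N : {set gT}) : seq nat :=
  undup [seq codegree 'chi_i | i in Irr_over G N].

Definition cod_primes (gT : finGroupType) (G : {group gT}) (N : {set gT}) :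
    seq nat :=
  undup (flatten [seq primes c | c <- cod G N]).

Lemma mem_cod_primes (gT : finGroupType) (G : {group gT}) (N : {set gT}) p :
  reflect (prime p /\ exists2 i, i \in Irr_over G N & (p %| codegree 'chi_i)%N)
          (p \in cod_primes G N).
Proof.
have cod_gt0 i : (0 < codegree 'chi[G]_i)%N.
  rewrite -(ltr0n algC) codegreeE divr_gt0 ?irr1_gt0 //.
  by rewrite ltr0n indexg_gt0.
rewrite mem_undup; apply: (iffP flatten_mapP).
  case=> c; rewrite mem_undup => /imageP[i Ni ->].
  by rewrite mem_primes => /and3P[pr_p _ dv]; split=> //; exists i.
case=> pr_p [i Ni dv]; exists (codegree 'chi_i).
  by rewrite mem_undup; apply: image_f.
by rewrite mem_primes pr_p cod_gt0.
Qed.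

(* The graph Gamma(G | N): its vertex type is the finite type of the primes in
   cod_primes G N, and its edges are given by cod_graph G N. *)
Definition cod_vertex (gT : finGroupType) (G : {group gT}) (N : {set gT}) :
    finType :=
  seq_sub (cod_primes G N).

Definition cod_graph (gT : finGroupType) (G : {group gT}) (N : {set gT}) :
    rel (cod_vertex G N) :=
  fun p q =>
    (p != q) &&
    [exists i in Irr_over G N, (ssval p * ssval q %| codegree 'chi_i)%N].

Arguments cod_graph {gT} G N _ _.

(* Some two vertices are not joined by a path; in particular the graph with no
   vertices is not disconnected. *)
Definition disconnected (V : finType) (e : rel V) : Prop :=
  exists p q : V, ~~ connect e p q.

(* Main.v *)
Require Import Defs.
From mathcomp Require Import all_boot all_order all_algebra.
From mathcomp Require Import all_fingroup all_solvable all_field all_character.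

Set Implicit Arguments.
Unset Strict Implicit.
Unset Printing Implicit Defensive.

Import Order.TTheory GRing.Theory Num.Theory GroupScope.
Local Open Scope ring_scope.

(** Write G' for the derived subgroup. Since the graph of G over G' is
    disconnected and there are just two codegrees a and b of nonlinear
    characters, a and b are coprime and both exceed 1. The codegree of a linear
    character divides |G : G'|, so if |G : G'| is coprime to b, say, then no
    edge of the graph of G leaves the set of prime divisors of b, and the graph
    is disconnected (cod_graph_separated). What has to be excluded is that
    |G : G'| shares a prime p with a and a prime q with b
    (coprime_codegree_index_der1).

    Choose L normal in G and maximal with G / L nonabelian. In H = G / L every
    nontrivial normal subgroup contains M = H', so the nonlinear characters of H
    are faithful. Twisting such a character, viewed in G, by a linear character
    lambda of G of prime order r, where r does not divide |Z(H)|, gives a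
    character with kernel the intersection of L and ker lambda; its codegree is
    a multiple of the old one and still lies in {a, b}, which forces L to be in
    ker lambda (cfker_sub_lin). Hence r divides |H : M|. Three cases remain.

    - Z(H) is not 1. Then H is nilpotent, hence a group of prime power order
      (pgroup_min_der1). It follows that p and q are both equal to that prime.
    - Z(H) = 1 and M is abelian. Then M is its own centralizer, nonlinear
      characters are induced from M, their codegree is |M|, and |M| is coprime
      to |H : M| (codegree_abelian_der1). But p or q divides both numbers.
    - Z(H) = 1 and M is not abelian, hence perfect by minimality. This
      contradicts the coprimality of a and b (der1_not_perfect). If theta in
      Irr(M) lies under a nonlinear chi, then chi(1) divides theta(1) |H : M|,
      so |M| divides cod(chi) theta(1). Were both codegrees to occur, |M| would
      divide a product theta_a(1) theta_b(1), which is less than |M|. So all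
      nonlinear characters have the same degree, and an argument of Thompson
      shows that a prime dividing it cannot divide |M| (perfect_der1_p'group).
      As theta(1) divides both, M has only linear characters, which is absurd.
*)

(** * Degrees and codegrees *)

Section Degrees.

Variable gT : finGroupType.
Implicit Types G H M N : {group gT}.

Definition irr_deg G (i : Iirr G) : nat := Num.truncn ('chi_i 1%g).

Lemma irr_degE G (i : Iirr G) : 'chi_i 1%g = (irr_deg i)%:R.
Proof. by rewrite /irr_deg irr1_degree natrK. Qed.

Lemma irr_deg_gt0 G (i : Iirr G) : (0 < irr_deg i)%N.
Proof. by rewrite -(ltr0n algC) -irr_degE irr1_gt0. Qed.

Lemma codegreeM G (i : Iirr G) :
  (codegree 'chi_i * irr_deg i)%N = #|G : cfker 'chi_i|.
Proof.
apply/eqP; rewrite -eqC_nat natrM codegreeE -irr_degE divfK ?irr1_neq0 //.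
Qed.

Lemma irr_deg_lin G (i : Iirr G) :
  (irr_deg i == 1%N) = (G^`(1)%g \subset cfker 'chi_i).
Proof.
by rewrite -lin_irr_der1 [in RHS]qualifE /= irr_char -eqC_nat -irr_degE.
Qed.

Lemma codegree_gt0 G (i : Iirr G) :
  (0 < codegree 'chi_i)%N.
Proof. by rewrite -(ltn_pmul2r (irr_deg_gt0 i)) mul0n codegreeM indexg_gt0. Qed.

Lemma codegree_lin_dvd G (i : Iirr G) :
    (G^`(1)%g \subset cfker 'chi_i) ->
  (codegree 'chi_i %| #|G : G^`(1)%g|)%N.
Proof.
move=> G'i; have:= codegreeM i; 
have/eqP->: irr_deg i == 1%N by rewrite irr_deg_lin.
by rewrite muln1 => ->; apply: indexgS.
Qed.

Lemma irr_deg_dvd_card G (i : Iirr G) : (irr_deg i %| #|G|)%N.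
Proof. by have := dvd_irr1_cardG i; rewrite irr_degE dvdC_nat. Qed.

Lemma sum_irr_deg_sq G : (\sum_(i : Iirr G) irr_deg i ^ 2)%N = #|G|.
Proof.
apply/eqP; rewrite -eqC_nat natr_sum -irr_sum_square; apply/eqP.
by apply: eq_bigr => i _; rewrite natrX irr_degE.
Qed.

Lemma irr_deg_sq_lt G (i : Iirr G) : i != 0 -> (irr_deg i ^ 2 < #|G|)%N.
Proof.
move=> nzi; rewrite -sum_irr_deg_sq (bigD1 i) //= (bigD1 0) 1?eq_sym //=.
have ->: irr_deg (0 : Iirr G) = 1%N.
  by apply/eqP; rewrite irr_deg_lin cfker_irr0 der_sub.
by rewrite addnA addn1 leq_addr.
Qed.

Lemma irr_deg_constt_Res G M (i : Iirr G) (j : Iirr M) :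
    M <| G -> j \in irr_constt ('Res[M] 'chi_i) ->
  (irr_deg j %| irr_deg i)%N.
Proof.
move=> nsMG /(dvdn_constt_Res1_irr1 nsMG)[n /eqP].
by rewrite !irr_degE -natrM eqC_nat => /eqP->; apply: dvdn_mull.
Qed.

(** * Characters over an abelian quotient *)

(** The irreducible characters over a common constituent of a normal subgroup
    with abelian quotient differ by a linear factor: they are constituents of
    the character induced from a restriction, which is the product of the
    original character with the sum of the linear characters of the quotient. *)
Lemma eq_irr_deg_over G M (i k : Iirr G) (j : Iirr M) :
    M <| G -> abelian (G / M) ->
    j \in irr_constt ('Res[M] 'chi_i) -> j \in irr_constt ('Res[M] 'chi_k) ->
  irr_deg k = irr_deg i.
Proof.
move=> nsMG cGM ij kj.
(* 'chi_j is a constituent of both restrictions, so these are not orthogonal. *)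
have nz: '['chi_k, 'Ind[G] ('Res[M] 'chi_i)] != 0.
  rewrite -cfdot_Res_l.
  apply: contraTneq (oner_neq0 algC) => o_ki; rewrite -(cfnorm_irr j) negbK.
  apply/eqP; apply: constt_ortho_char kj ij o_ki;
    by rewrite cfRes_char ?irr_char.
have Res0: 'Res[M] 'chi[G]_0 = 'chi_0 by rewrite !irr0 rmorph1.
have [_ _ _ Ind0] := constt_Ind_ext nsMG Res0.
have: 'Ind[G] ('Res[M] 'chi_i) = 'Ind[G, M] 'chi_0 * 'chi_i.
  by rewrite -cfIndM ?normal_sub // irr0 mul1r.
move=> def; rewrite {}def {}Ind0 mulr_suml cfdot_sumr in nz.
have /existsP[b nzb]: [exists b : Iirr (G / M),
   '['chi_k, 'chi_b 1%g *: 'chi_(mul_mod_Iirr 0 b) * 'chi_i] != 0].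
  apply: contraR nz => /existsPn n0; rewrite big1 // => b _.
  by apply/eqP/negPn/n0.
have linb: 'chi_(mod_Iirr b) \is a linear_char.
  by rewrite mod_IirrE // cfMod_lin_char //; apply: char_abelianP.
have Eb: 'chi_(mul_mod_Iirr 0 b) * 'chi_i = 'chi_(mod_Iirr b) * 'chi_i.
  by rewrite /mul_mod_Iirr /mul_Iirr irr0 mulr1 irrK.
rewrite -scalerAl Eb cfdotZr in nzb.
have /irrP[l Dl] := mul_lin_irr linb (mem_irr i).
rewrite Dl cfdot_irr in nzb.
have Dkl: k = l by apply: contraNeq nzb => /negbTE->; rewrite mulr0.
by rewrite /irr_deg Dkl -Dl cfunE lin_char1 ?mul1r.
Qed.

(** The constituents of the character induced from 'chi_j all have the degree
    of 'chi_i, so that degree divides the degree of the induced character. *)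
Lemma irr_deg_dvd_over G M (i : Iirr G) (j : Iirr M) :
    M <| G -> abelian (G / M) -> j \in irr_constt ('Res[M] 'chi_i) ->
  (irr_deg i %| irr_deg j * #|G : M|)%N.
Proof.
move=> nsMG cGM ij; pose theta := 'Ind[G] 'chi_j.
have Ntheta: theta \is a character by rewrite cfInd_char ?irr_char.
pose e k := Num.truncn '[theta, 'chi_k].
have De k: '[theta, 'chi_k] = (e k)%:R.
  have /natrP[n Dn] := Cnat_cfdot_char Ntheta (irr_char k).
  by rewrite /e Dn natrK.
suff Dd: (irr_deg j * #|G : M|)%N = (\sum_k e k * irr_deg k)%N.
  rewrite Dd; apply: (big_ind (fun n => irr_deg i %| n)%N) => // [m n|k _].
  - exact: dvdn_add.
  have [-> | nz_k] := eqVneq (e k) 0; first by rewrite mul0n.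
  rewrite dvdn_mull // (eq_irr_deg_over nsMG cGM ij) //.
  by rewrite -constt_Ind_Res irr_consttE De pnatr_eq0.
apply/eqP; rewrite -eqC_nat mulnC natrM -irr_degE -cfInd1 ?normal_sub //.
rewrite -/theta {1}[theta]cfun_sum_cfdot sum_cfunE natr_sum; apply/eqP.
by apply: eq_bigr => k _; rewrite cfunE De natrM irr_degE.
Qed.

(** * Perfect derived subgroup *)

(** Thompson's theorem on normal complements, in the perfect case. Let P be a
    Sylow p-subgroup of H acting on Irr(M). A P-invariant theta of degree prime
    to p extends to MP, because its determinant is trivial; any irreducible
    character of H above the extension has degree prime to p, so it is linear
    and theta is trivial. In the sum of the squares of the degrees, the other
    P-invariant characters have degree divisible by p and the remaining ones
    form orbits of length divisible by p, whence #|M| = 1 modulo p. *)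
Lemma perfect_der1_p'group H p :
    let M := H^`(1)%G in
    M^`(1)%g = M -> prime p ->
    (forall i : Iirr H, ~~ (M \subset cfker 'chi_i) -> (p %| irr_deg i)%N) ->
  ~~ (p %| #|M|)%N.
Proof.
move=> M perfM pr_p p_nonlin; have nsMH: M <| H := der_normal 1 H.
have [sMH nMH] := andP nsMH.
have actIirr: is_action H (@conjg_Iirr _ M).
  split=> [y j k eq_jk | j y z Hy Hz].
    by apply/irr_inj/(can_inj (cfConjgK y)); rewrite -!conjg_IirrE eq_jk.
  by apply: irr_inj; rewrite !conjg_IirrE (cfConjgM _ nsMH).
pose ito := Action actIirr.
have [P sylP] := Sylow_exists p H; have [sPH pP p'HP] := and3P sylP.
(* Orbits are counted degree by degree; the trivial character is set apart. *)
pose S n := [set j : Iirr M | (j != 0) && (irr_deg j == n)].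
have actsS n : [acts P, on S n | ito].
  apply/subsetP=> y Py; rewrite !inE (subsetP sPH) //=; apply/subsetP=> j.
  rewrite !inE /= conjg_Iirr_eq0 => /andP[-> /eqP <-] /=.
  by rewrite -eqC_nat -!irr_degE conjg_IirrE cfConjg1.
have fixP1 j : j \in 'Fix_ito(P) -> ~~ (p %| irr_deg j)%N -> j = 0.
  move=> /afixP fixj p'j; pose R := (M <*> P)%G.
  have sMR: M \subset R by apply: joing_subl.
  have sRH: R \subset H by rewrite join_subG sMH.
  have nsMR: M <| R by apply: normalS nsMH.
  have nsRH: R <| H by apply: sub_der1_normal.
  have cRM: abelian (R / M).
    by apply: abelianS (der_abelian 0 H); apply: quotientS.
  have pRM: p.-nat #|R : M|.
    rewrite -card_quotient ?normal_norm // quotientYidl ?(subset_trans sPH) //.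
    exact: quotient_pgroup.
  have [] := extend_solvable_coprime_irr nsMR (abelian_sol cRM) (t := j).
  - rewrite join_subG sub_inertia /=; apply/subsetP=> y Py.
    rewrite inE (subsetP nMH) ?(subsetP sPH) //= -conjg_IirrE.
    by rewrite (fixj y Py : conjg_Iirr j y = j).
  - rewrite (pnat_coprime pRM) // pnatM andbC !(p'natE _ pr_p).
    rewrite p'j (_ : 'o('chi_j)%CF = 1%N) ?dvdn1 ?neq_ltn ?prime_gt1 ?orbT //.
    apply/eqP; rewrite -dvdn1 dvdn_cforder expr1; apply/eqP/cfun_inP=> x Mx.
    have lin_det := cfDet_lin_char 'chi_j.
    rewrite cfun1E Mx cfker1 ?lin_char1 //.
    by rewrite (subsetP (lin_char_der1 _)) ?perfM.
  move=> c [Dc _ _].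
  have [i] := constt_cfInd_irr c sRH; rewrite constt_Ind_Res => ic.
  have cHR: abelian (H / R) by rewrite sub_der1_abelian.
  have Mi: M \subset cfker 'chi_i.
    apply: contraLR (irr_deg_dvd_over nsRH cHR ic) => /p_nonlin p_i.
    apply: contraL p'j => /(dvdn_trans p_i); rewrite Euclid_dvdM // negbK.
    have ->: irr_deg c = irr_deg j by rewrite /irr_deg -Dc cfRes1.
    case/orP=> // /dvdn_trans/(_ (indexgS _ (joing_subr M P : P \subset R))).
    by apply: contraLR => _; rewrite -p'natE.
  apply/eqP; rewrite -subGcfker -Dc cfker_Res ?irr_char // subsetI subxx /=.
  apply: subset_trans (cfker_constt _ ic); rewrite ?cfRes_char ?irr_char //.
  by rewrite cfker_Res ?irr_char // subsetI sMR.
have dvS n : (p %| n ^ 2 * #|S n|)%N.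
  have [p_n | p'n] := boolP (p %| n)%N; first by rewrite dvdn_mulr ?dvdn_mull.
  rewrite dvdn_mull // /dvdn (pgroup_fix_mod pP (actsS n)) -/(dvdn _ _).
  rewrite (_ : 'Fix_(_ | _)(_) = set0) ?cards0 //; apply/setP=> j.
  rewrite in_set0; apply/negP=> /setIP[].
  rewrite inE => /andP[nzj /eqP Dn] /fixP1; rewrite Dn => /(_ p'n) j0.
  by rewrite j0 eqxx in nzj.
have: (p %| \sum_(j : Iirr M | j != 0%R) irr_deg j ^ 2)%N.
  rewrite (partition_big (fun j => inord (irr_deg j) : 'I_#|M|.+1) predT) //=.
  apply: (big_ind (fun n => p %| n)%N) => // [m n|n _]; first exact: dvdn_add.
  rewrite (eq_bigl (fun j => j \in S n)) => [|j]; last first.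
    rewrite !inE; congr (_ && _); rewrite -val_eqE /= inordK // ltnS.
    by rewrite dvdn_leq ?cardG_gt0 ?irr_deg_dvd_card.
  rewrite (eq_bigr (fun _ => n ^ 2)%N) => [|j].
    by rewrite sum_nat_const mulnC.
  by rewrite inE => /andP[_ /eqP->].
move=> pS; rewrite -sum_irr_deg_sq (bigD1 0) //= dvdn_addl //.
rewrite /irr_deg irr0 cfun11 truncn1 dvdn1.
by apply: contraTneq pr_p => ->.
Qed.

(** The degree bound irr_deg_sq_lt is what rules out two distinct codegrees:
    #|M| would divide the product of two degrees, whose square is smaller than
    the square of #|M|. With a single codegree, all nonlinear characters have
    the same degree, and a prime divisor of a nonlinear degree of M would divide
    that common degree as well as #|M|, contrary to perfect_der1_p'group. *)
Lemma der1_not_perfect H a b :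
    let M := H^`(1)%G in
    M :!=: 1%g -> coprime a b ->
    (forall i : Iirr H, ~~ (M \subset cfker 'chi_i) ->
       cfker 'chi_i = 1%g /\ codegree 'chi_i \in [:: a; b]) ->
  M^`(1)%g != M.
Proof.
move=> M ntM co_ab codH; have nsMH: M <| H := der_normal 1 H.
apply/eqP=> perfM; have cHM: abelian (H / M) := der_abelian 0 H.
have oH i : ~~ (M \subset cfker 'chi_i) ->
  (codegree 'chi[H]_i * irr_deg i = #|M| * #|H : M|)%N.
  by move=> /codH[ker1 _]; rewrite codegreeM ker1 indexg1 Lagrange ?normal_sub.
have M_dvd i j : ~~ (M \subset cfker 'chi_i) ->
    j \in irr_constt ('Res[M] 'chi[H]_i) ->
  (#|M| %| codegree 'chi_i * irr_deg j)%N.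
  move=> Mi ij; rewrite -(dvdn_pmul2r (indexg_gt0 H M)) -(oH i Mi) -mulnA.
  by rewrite dvdn_mul // irr_deg_dvd_over.
have ltM i j : ~~ (M \subset cfker 'chi_i) ->
    j \in irr_constt ('Res[M] 'chi[H]_i) -> (irr_deg j ^ 2 < #|M|)%N.
  move=> Mi ij; apply: irr_deg_sq_lt; apply: contraNneq Mi => j0.
  by apply: constt0_Res_cfker nsMH _; rewrite -j0.
have cod1 i k : ~~ (M \subset cfker 'chi_i) -> ~~ (M \subset cfker 'chi_k) ->
  codegree 'chi[H]_i = a -> codegree 'chi[H]_k = b -> False.
  move=> Mi Mk Di Dk.
  have [[j ij] [l kl]] := (constt_cfRes_irr M i, constt_cfRes_irr M k).
  have: (#|M| %| irr_deg j * irr_deg l)%N.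
    rewrite -[(_ * _)%N]mul1n -(eqP co_ab) muln_gcdl dvdn_gcd.
    rewrite -{1}Di -Dk mulnA dvdn_mulr ?M_dvd //=.
    by rewrite mulnCA dvdn_mull ?M_dvd.
  move/dvdn_leq; rewrite muln_gt0 !irr_deg_gt0 => /(_ isT); apply/negP.
  rewrite -ltnNge -ltn_sqr expnMn expnS expn1.
  apply: ltn_mul; [exact: ltM ij | exact: ltM kl].
(* As cod1 forbids distinct codegrees, all faithful degrees are #|H| / c. *)
have eq_deg (i k : Iirr H) :
    ~~ (M \subset cfker 'chi_i) -> ~~ (M \subset cfker 'chi_k) ->
  irr_deg i = irr_deg k.
  move=> Mi Mk; have: codegree 'chi[H]_i = codegree 'chi_k.
    have [[_ Ci] [_ Ck]] := (codH i Mi, codH k Mk); move: Ci Ck.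
    rewrite !inE => /orP[]/eqP Ci /orP[]/eqP Ck; rewrite ?Ci ?Ck //.
      by case: (cod1 i k).
    by case: (cod1 k i).
  move=> eq_cod; apply/eqP; rewrite -(eqn_pmul2l (m := codegree 'chi_i)).
    by rewrite {2}eq_cod !oH.
  exact: codegree_gt0.
(* M is perfect and nontrivial, so it has a nonlinear character. *)
have /existsP[j nlj]: [exists j : Iirr M, irr_deg j != 1%N].
  apply: contraR ntM => /existsPn lin; rewrite -perfM; apply/eqP/derG1P.
  by apply/char_abelianP=> j; rewrite lin_irr_der1 -irr_deg_lin; apply/negPn/lin.
have [i] := constt_cfInd_irr j (normal_sub nsMH); rewrite constt_Ind_Res => ij.
have Mi: ~~ (M \subset cfker 'chi_i).
  rewrite -irr_deg_lin; apply: contraNneq nlj => i1.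
  by rewrite -dvdn1 -i1 (irr_deg_constt_Res nsMH).
have pr_p: prime (pdiv (irr_deg j)).
  by rewrite pdiv_prime // ltn_neqAle eq_sym nlj irr_deg_gt0.
suff: ~~ (pdiv (irr_deg j) %| #|M|)%N.
  by rewrite (dvdn_trans (pdiv_dvd _)) ?irr_deg_dvd_card.
apply: perfect_der1_p'group => // k Mk; rewrite (eq_deg k i) //.
by rewrite (dvdn_trans (pdiv_dvd _)) ?(irr_deg_constt_Res nsMH).
Qed.

(** * Minimal abelian derived subgroup, trivial center *)

Lemma cent_joing_der1_normal H y :
  y \in H -> 'C_H(H^`(1) <*> <[y]>)%g <| H.
Proof.
move=> Hy; rewrite /normal subsetIl normsI ?normG ?norms_cent //.
by rewrite sub_der1_norm ?joing_subl // join_subG der_sub cycle_subG.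
Qed.

(** For y outside C(M), the normal subgroup of the elements centralizing both M
    and y does not contain M, so it is trivial. Then x |-> [~ x, y] embeds
    'C_H(M) in its subgroup M, so the two are equal. *)
Lemma cent_abelian_der1 H :
    let M := H^`(1)%G in
    (forall N, N <| H -> N :!=: 1%g -> M \subset N) ->
    abelian M -> M :!=: 1%g -> 'Z(H) = 1%g ->
  'C_H(M) = M.
Proof.
move=> M minM cMM ntM Z1; have nsMH: M <| H := der_normal 1 H.
have sMC: M \subset 'C_H(M) by rewrite subsetI normal_sub.
have /subsetPn[y Hy Cy]: ~~ (H \subset 'C(M)).
  apply: contra ntM => cMH; rewrite -subG1 -Z1 subsetI normal_sub //.
  by rewrite centsC.
pose D := 'C_H(M <*> <[y]>)%G.
have nsDH: D <| H := cent_joing_der1_normal Hy.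
have D1: D :=: 1%g.
  apply: contraNeq Cy => /(minM D nsDH)/subsetIP[_].
  by rewrite /= centY subsetI => /andP[_]; rewrite centsC cycle_subG.
apply/eqP; rewrite eq_sym eqEcard sMC /=.
have injf: {in 'C_H(M) &, injective (fun x => [~ x, y])}.
  move=> x z Cx Cz eq_xz; apply/esym/eqP; rewrite eq_mulgV1 -in_set1.
  have Czx: (z * x^-1)%g \in 'C_H(M) by rewrite groupM ?groupV.
  rewrite -[[set 1%g]]D1 /D /= centY cent_cycle setIA inE Czx.
  apply/cent1P.
  have Dxy: (x ^ y = x * (z^-1 * z ^ y))%g.
    by rewrite -commgEl -eq_xz commgEl mulKVg.
  apply/commgP/conjg_fixP.
  by rewrite conjMg conjVg Dxy mulgA invMg mulKVg invMg invgK.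
rewrite -(card_in_imset injf) subset_leq_card //.
apply/subsetP=> _ /imsetP[x /setIP[Hx _] ->]; exact: mem_commg.
Qed.

(** A nontrivial theta in Irr(M) has inertia group T = M: [~: T, M] is normal
    in H and contained in the kernel of theta, so T centralizes M. Thus theta
    induces an irreducible character of degree #|H : M|. For coprimality, a
    Sylow subgroup P of H that meets M nontrivially does so in an element z != 1
    of its center. For each x in P, the normal subgroup 'C_H(M <*> <[x]>)
    contains z, hence M by minimality; thus P lies in 'C_H(M) = M. *)
Lemma codegree_abelian_der1 H :
    let M := H^`(1)%G in
    (forall N, N <| H -> N :!=: 1%g -> M \subset N) ->
    abelian M -> M :!=: 1%g -> 'Z(H) = 1%g ->
    (forall i : Iirr H, ~~ (M \subset cfker 'chi_i) -> codegree 'chi_i = #|M|)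
  /\ coprime #|M| #|H : M|.
Proof.
move=> M minM cMM ntM Z1; have nsMH: M <| H := der_normal 1 H.
have [sMH nMH] := andP nsMH.
have CM: 'C_H(M) = M := cent_abelian_der1 minM cMM ntM Z1.
split=> [i Mi | ].
  have ker1: cfker 'chi_i = 1%g.
    by apply/eqP; apply: contraR Mi => /(minM _ (cfker_normal _)).
  have [j ij] := constt_cfRes_irr M i.
  have nzj: j != 0.
    apply: contraNneq Mi => j0.
    by apply: constt0_Res_cfker nsMH _; rewrite -j0.
  have IM: 'I_H['chi_j] \subset M.
    apply: subset_trans (_ : _ \subset 'C_H(M)) _; last by rewrite CM.
    rewrite subsetI Inertia_sub /=; set T := 'I_H['chi_j]%G.
    have nsTH: T <| H by rewrite sub_der1_normal ?Inertia_sub ?sub_Inertia.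
    have kerTM: [~: T, M] \subset cfker 'chi_j.
      rewrite commGC gen_subG; apply/subsetP=> _ /imset2P[x y Mx Ty ->].
      have lin_j: 'chi_j \is a linear_char by apply/char_abelianP.
      have [Hy /setIdP[nMy /eqP Dj]] := setIP Ty.
      have Mxy: (x ^ y)%g \in M by rewrite memJ_norm.
      rewrite /= cfkerEirr inE commgEl lin_charM ?groupV // lin_charV //.
      have ->: 'chi_j (x ^ y)%g = 'chi_j x by rewrite -{1}Dj cfConjgE // conjgK.
      by rewrite mulVf ?lin_char_neq0 // lin_char1.
    have nsTMH: [~: T, M] <| H.
      by rewrite /normal comm_subG ?normsR ?normal_norm ?normal_sub.
    rewrite (sameP commG1P eqP); apply: contraR nzj => nt.
    by rewrite -subGcfker (subset_trans (minM _ nsTMH nt)).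
  have defT: 'I_H['chi_j]%G = M.
    by apply/group_inj/eqP; rewrite eqEsubset IM sub_Inertia.
  have{defT} /irrP[k Dk]: 'Ind[H] 'chi_j \in irr H.
    have [] := constt_Inertia_bijection j nsMH.
    by rewrite defT cfInd_id => -> //; rewrite constt_irr !inE.
  have Dik: i = k.
    by apply/eqP; move: ij; rewrite -constt_Ind_Res Dk constt_irr !inE.
  have deg_i: irr_deg i = #|H : M|.
    apply/eqP; rewrite -eqC_nat -irr_degE Dik -Dk cfInd1 // lin_char1 ?mulr1 //.
    exact/char_abelianP.
  apply/eqP; rewrite -(eqn_pmul2r (indexg_gt0 H M)) -{1}deg_i codegreeM.
  by rewrite ker1 indexg1 Lagrange.
rewrite coprime_sym coprime_has_primes ?cardG_gt0 ?indexg_gt0 //.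
apply/hasPn=> p; rewrite mem_primes => /and3P[pr_p _ pM].
rewrite mem_primes pr_p indexg_gt0 /=.
have [P sylP] := Sylow_exists p H; have [sPH pP p'HP] := and3P sylP.
have nsPM: P :&: M <| P := normalGI sPH nsMH.
have ntPM: P :&: M != 1%g.
  apply: contraTneq pM => PM1.
  have /card_Hall/esym/eqP := Hall_setI_normal nsMH sylP.
  by rewrite /= PM1 cards1 p_part_eq1 mem_primes pr_p cardG_gt0.
have [z] := trivgPn _ (meet_center_nil (pgroup_nil pP) nsPM ntPM).
case/setIP=> /setIP[Pz Mz] /setIP[_ cPz] ntz.
suff sPM: P \subset M.
  apply: contraTN p'HP => p_dv; rewrite p'natE // negbK.
  exact: dvdn_trans p_dv (indexgS _ sPM).
rewrite -CM subsetI sPH /=; apply/subsetP=> x Px; have Hx := subsetP sPH x Px.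
suff: M \subset 'C_H(M <*> <[x]>).
  by rewrite /= centY !subsetI => /and3P[_ _]; rewrite centsC cycle_subG.
apply: minM (cent_joing_der1_normal Hx) _; apply/trivgPn; exists z => //=.
rewrite centY cent_cycle 2!in_setI (subsetP sMH) // (subsetP cMM) //=.
exact/cent1P/(centP cPz).
Qed.

(** * Minimal derived subgroup, nontrivial center *)

(** The derived subgroup is central, so H is nilpotent; for a prime p dividing
    #|M|, the p'-core is a normal subgroup that cannot contain M. *)
Lemma pgroup_min_der1 H :
    let M := H^`(1)%G in
    (forall N, N <| H -> N :!=: 1%g -> M \subset N) ->
    M :!=: 1%g -> 'Z(H) != 1%g ->
  exists2 p, prime p & p.-group H.
Proof.
move=> M minM ntM ntZ.
have sMZ: M \subset 'Z(H) := minM _ (center_normal H) ntZ.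
have nilH: nilpotent H.
  by rewrite -quotient_center_nil abelian_nil ?sub_der1_abelian.
have pr_p: prime (pdiv #|M|) by rewrite pdiv_prime // cardG_gt1.
exists (pdiv #|M|) => //; set p := pdiv _ in pr_p *.
have [_ defH _ _] := dprodP (nilpotent_pcoreC p nilH).
suff p'1: 'O_p^'(H)%g = 1%g by rewrite -defH p'1 mulg1 pcore_pgroup.
apply: contraTeq (pdiv_dvd #|M|) => /(minM _ (pcore_normal _ _)) sM.
by rewrite -p'natE //; apply: pgroupS sM (pcore_pgroup _ _).
Qed.

(** * Twisting by linear characters *)

Lemma Cauchy_lin_char G p :
    prime p -> (p %| #|G : G^`(1)%g|)%N ->
  exists2 lambda : 'CF(G), lambda \is a linear_char & #[lambda]%CF = p.
Proof.
move=> pr_p; have [linG [cF [_ oL linF _] [_ _ _ _ Fo]]] := lin_char_group G.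
rewrite -oL -cardsT => p_dv.
have [x _ ox] := Cauchy (G := [set: linG]%G) pr_p p_dv.
by exists (cF x); rewrite ?Fo.
Qed.

Lemma cforder_lin_dvd_index G (lambda : 'CF(G)) :
  lambda \is a linear_char -> (#[lambda]%CF %| #|G : G^`(1)%g|)%N.
Proof.
have [linG [cF [_ oL _ ontoF] [_ _ _ _ Fo]]] := lin_char_group G.
by case/ontoF=> u ->; rewrite Fo -oL -cardsT order_dvdG ?inE.
Qed.

Lemma coprime_expr_eq1 (z : algC) m n :
  coprime m n -> z ^+ m = 1 -> z ^+ n = 1 -> z = 1.
Proof.
case: m => [|m] co_mn zm zn.
  by move: co_mn zn; rewrite /coprime gcd0n => /eqP->.
case: (egcdnP n (ltn0Sn m)) => km kn def _; rewrite (eqP co_mn) in def.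
have: z ^+ (km * m.+1) = 1 by rewrite mulnC exprM zm expr1n.
by rewrite def addn1 exprS mulnC exprM zn expr1n mulr1.
Qed.

(** If x lies in the kernel of the product, then 'chi_i x has absolute value
    'chi_i 1, so the coset of x is central modulo the kernel of 'chi_i and
    x ^+ #|Z| lies in that kernel. Hence lambda x is a root of unity of order
    dividing both #|Z| and the order of lambda, that is, lambda x = 1. *)
Lemma cfker_mul_lin G (lambda : 'CF(G)) (i : Iirr G) :
    lambda \is a linear_char ->
    coprime #[lambda]%CF #|'Z(G / cfker 'chi_i)%g| ->
  cfker (lambda * 'chi_i) = cfker lambda :&: cfker 'chi_i.
Proof.
move=> lin_l co_l; have Nl := lin_charW lin_l.
have Nli: lambda * 'chi_i \is a character by rewrite rpredM ?irr_char.
set K := cfker 'chi_i in co_l *.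
apply/eqP; rewrite eqEsubset cfker_mul andbT; apply/subsetP=> x kx.
have ker_eq y :
  y \in cfker (lambda * 'chi_i) -> lambda y * 'chi_i y = 'chi_i 1%g.
  by move/cfker1; rewrite !cfunE lin_char1 // mul1r.
have Gx: x \in G by rewrite (subsetP (cfker_sub _) x kx).
have Zx: x \in 'Z('chi_i)%CF.
  rewrite /cfcenter irr_char inE Gx -[`|_|]mul1r -(normC_lin_char lin_l Gx).
  by rewrite -normrM ker_eq ?ger0_norm ?eqxx ?char1_ge0 ?irr_char.
have xnK: (x ^+ #|'Z(G / K)%g|)%g \in K.
  have Nx: x \in 'N(K) by rewrite (subsetP (cfker_norm _)).
  rewrite coset_idr ?groupX // morphX //; apply/eqP.
  rewrite -order_dvdn order_dvdG //= -cfcenter_eq_center mem_quotient //.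
have l_x1: lambda x = 1.
  apply: coprime_expr_eq1 co_l _ _.
    by apply/dvdn_cforderP: Gx; apply: dvdnn.
  rewrite -lin_charX //; apply: (mulIf (irr1_neq0 i)).
  by rewrite -{1}(cfker1 xnK) ker_eq ?mul1r ?groupX.
rewrite /K in_setI cfkerEirr cfkerEchar // !inE Gx l_x1 lin_char1 // eqxx /=.
by have:= ker_eq x kx; rewrite l_x1 mul1r => ->.
Qed.

(** The twist lambda * 'chi_i has codegree n * codegree 'chi_i, where n is the
    index in cfker 'chi_i of its intersection with cfker lambda. Two coprime
    numbers greater than 1 do not divide one another, so n = 1. *)
Lemma cfker_sub_lin G a b (lambda : 'CF(G)) (i : Iirr G) :
    coprime a b -> (1 < a)%N -> (1 < b)%N ->
    (forall k : Iirr G, ~~ (G^`(1)%g \subset cfker 'chi_k) ->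
       codegree 'chi_k \in [:: a; b]) ->
    ~~ (G^`(1)%g \subset cfker 'chi_i) -> lambda \is a linear_char ->
    coprime #[lambda]%CF #|'Z(G / cfker 'chi_i)%g| ->
  cfker 'chi_i \subset cfker lambda.
Proof.
move=> co_ab a1 b1 codG nli lin_l co_l; set K := cfker 'chi_i.
have /irrP[k Dk] := mul_lin_irr lin_l (mem_irr i).
have deg_k: irr_deg k = irr_deg i.
  by rewrite /irr_deg -Dk cfunE lin_char1 ?mul1r.
have nlk: ~~ (G^`(1)%g \subset cfker 'chi_k).
  by rewrite -irr_deg_lin deg_k irr_deg_lin.
have ker_k: cfker 'chi_k = K :&: cfker lambda.
  by rewrite -Dk cfker_mul_lin // setIC.
have: (codegree 'chi_k = codegree 'chi_i * #|K : cfker lambda|)%N.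
  apply/eqP; rewrite -(eqn_pmul2r (irr_deg_gt0 i)) -{1}deg_k codegreeM mulnAC.
  by rewrite codegreeM ker_k -(indexgI K) Lagrange_index ?subsetIl ?cfker_sub.
suff co1 c d n : (c \in [:: a; b] -> d \in [:: a; b] -> d = c * n -> n = 1)%N.
  by move/co1 => /(_ (codG i nli) (codG k nlk))/eqP; rewrite indexg_eq1.
rewrite !inE => /orP[]/eqP-> /orP[]/eqP-> def.
- by apply/eqP; rewrite -(eqn_pmul2l (ltnW a1)) muln1 -def.
- by move: co_ab a1; rewrite def /coprime gcdnMr => /eqP->.
- by move: co_ab b1; rewrite def /coprime gcdnC gcdnMr => /eqP->.
by apply/eqP; rewrite -(eqn_pmul2l (ltnW b1)) muln1 -def.
Qed.

End Degrees.

(** * The abelianization and the two codegrees *)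

Lemma codegree_mod (gT : finGroupType) (G N : {group gT}) (i : Iirr (G / N)) :
    N <| G -> cfker 'chi_i = 1%g ->
  cfker 'chi_(mod_Iirr i) = N /\ codegree 'chi_(mod_Iirr i) = codegree 'chi_i.
Proof.
move=> nsNG ker1; have ker_mod: cfker 'chi_(mod_Iirr i) = N.
  apply/eqP; rewrite eqEsubset mod_IirrE // cfker_mod // andbT.
  rewrite -quotient_sub1 ?(subset_trans (cfker_sub _)) ?normal_norm //.
  by rewrite (quotient_cfker_mod set0 _ nsNG) ker1.
split=> //; rewrite /codegree ker_mod ker1 indexg1 card_quotient ?normal_norm //.
by rewrite mod_IirrE // cfMod1.
Qed.

(** A maximal normal subgroup L with nonabelian quotient H is used to compare
    #|G : G^`(1)| with #|H : H^`(1)|: a prime divisor r of the former divides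
    the latter as soon as r is coprime to the order of the center of H. *)
Theorem coprime_codegree_index_der1 (gT : finGroupType) (G : {group gT}) a b :
    coprime a b -> (1 < a)%N -> (1 < b)%N -> ~~ abelian G ->
    (forall k : Iirr G, ~~ (G^`(1)%g \subset cfker 'chi_k) ->
       codegree 'chi_k \in [:: a; b]) ->
  coprime a #|G : G^`(1)%g| || coprime b #|G : G^`(1)%g|.
Proof.
move=> co_ab a1 b1 nabG codG; apply/norP=> [[]].
rewrite !coprime_has_primes ?indexg_gt0 ?(ltnW a1) ?(ltnW b1) // !negbK.
move=> /hasP[p Gp ap] /hasP[q Gq bq].
have{Gp ap} [pr_p Gp ap]: [/\ prime p, (p %| #|G : G^`(1)%g|)%N & (p %| a)%N].
  by move: Gp ap; rewrite /= !mem_primes => /and3P[-> _ ->] /and3P[_ _ ->].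
have{Gq bq} [pr_q Gq bq]: [/\ prime q, (q %| #|G : G^`(1)%g|)%N & (q %| b)%N].
  by move: Gq bq; rewrite /= !mem_primes => /and3P[-> _ ->] /and3P[_ _ ->].
have not_ab r : prime r -> (r %| a)%N -> (r %| b)%N -> False.
  move=> pr_r ra rb; have: (r %| gcdn a b)%N by rewrite dvdn_gcd ra.
  by rewrite (eqP co_ab) dvdn1 => /eqP r1; rewrite r1 in pr_r.
pose P L := (L <| G) && ~~ (G^`(1)%g \subset L).
(* Maximality of L makes H' the least nontrivial normal subgroup of H = G / L. *)
have [L /maxgroupP[/andP[nsLG nLG'] maxL]]: {L : {group gT} | [max L | P L]}.
  apply: ex_maxgroup; exists 1%G; rewrite /P normal1 /= subG1.
  by apply: contra nabG => /eqP/derG1P.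
pose H := (G / L)%G; pose M := H^`(1)%G.
have defM: M :=: (G^`(1) / L)%g by rewrite /= quotient_der ?normal_norm.
have minM (N : {group coset_of L}) : N <| H -> N :!=: 1%g -> M \subset N.
  move=> nsNH ntN; have [K defN sLK nsKG] := inv_quotientN nsLG nsNH.
  rewrite defM defN quotientS //; apply: contraR ntN => nKG'.
  by rewrite defN (maxL K) ?trivg_quotient // /P nsKG.
have ntM: M :!=: 1%g.
  apply: contra nLG' => /eqP M1; rewrite -quotient_sub1 -?defM ?M1 //.
  by rewrite (subset_trans (der_sub _ _)) ?normal_norm.
have ker1 (i : Iirr H) : ~~ (M \subset cfker 'chi_i) -> cfker 'chi_i = 1%g.
  by move=> nli; apply/eqP; apply: contraR nli => /(minM _ (cfker_normal _)).
have nl_mod (i : Iirr H) : ~~ (M \subset cfker 'chi_i) ->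
  ~~ (G^`(1)%g \subset cfker 'chi_(mod_Iirr i)).
  by move=> nli; have [-> _] := codegree_mod nsLG (ker1 i nli).
have codH (i : Iirr H) : ~~ (M \subset cfker 'chi_i) ->
  codegree 'chi_i \in [:: a; b].
  by move=> nli; have [_ <-] := codegree_mod nsLG (ker1 i nli); apply/codG/nl_mod.
have [i nli]: exists i : Iirr H, ~~ (M \subset cfker 'chi_i).
  apply/existsP; apply: contraR ntM => /existsPn lin.
  apply/eqP/derG1P/char_abelianP=> j; rewrite lin_irr_der1.
  exact/negPn/lin.
have dvH r : prime r -> (r %| #|G : G^`(1)%g|)%N -> coprime r #|'Z(H)| ->
  (r %| #|H : M|)%N.
  move=> pr_r /(Cauchy_lin_char pr_r)[lambda lin_l o_l] co_r.
  have [ker_i _] := codegree_mod nsLG (ker1 i nli).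
  have sLl: L \subset cfker lambda.
    rewrite -ker_i; apply: (cfker_sub_lin co_ab) => //; first exact: nl_mod.
    by rewrite o_l ker_i.
  have := cforder_lin_dvd_index (cfQuo_lin_char L lin_l).
  by rewrite cforder_quo // o_l.
have [Z1 | ntZ] := eqVneq 'Z(H)%g 1%g.
  have{dvH} dvH r : prime r -> (r %| #|G : G^`(1)%g|)%N -> (r %| #|H : M|)%N.
    by move=> pr_r Gr; apply: dvH; rewrite // Z1 cards1 coprimen1.
  have [cMM | ncMM] := boolP (abelian M).
    have [codM co_M] := codegree_abelian_der1 minM cMM ntM Z1.
    have coM r : prime r -> (r %| #|G : G^`(1)%g|)%N -> (r %| #|M|)%N -> False.
      move=> pr_r /(dvH r pr_r) Hr Mr.
      by have := coprime_dvdl Mr co_M; rewrite prime_coprime // Hr.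
    have:= codH i nli; rewrite codM // !inE.
    by case/orP=> /eqP DM; [apply: (coM p) | apply: (coM q)]; rewrite ?DM.
  have /negP[]: M^`(1)%g != M.
    by apply: (der1_not_perfect ntM co_ab) => k nlk; rewrite ker1 ?codH.
  have nsM'H: M^`(1)%G <| H := char_normal_trans (der_char 1 M) (der_normal 1 H).
  rewrite eqEsubset der_sub (minM _ nsM'H) //.
  by apply: contra ncMM => /eqP/derG1P.
(* A prime other than r is coprime to #|'Z(H)|, so dvH would make it divide #|H|. *)
have [r pr_r rH] := pgroup_min_der1 minM ntM ntZ.
have r_dv s : prime s -> (s %| #|H|)%N -> s = r.
  by move=> pr_s Hs; apply/eqP; apply: (pgroupP rH).
have co_Z s : prime s -> s != r -> coprime s #|'Z(H)|.
  move=> pr_s; apply: contraR; rewrite prime_coprime // negbK => /dvdn_trans Zs.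
  by apply/eqP/r_dv/Zs/cardSg/center_sub.
have eq_r s : prime s -> (s %| #|G : G^`(1)%g|)%N -> s = r.
  move=> pr_s Gs; have [// | ne_sr] := eqVneq s r; apply: r_dv => //.
  exact: dvdn_trans (dvH s pr_s Gs (co_Z s pr_s ne_sr)) (dvdn_indexg _ _).
by apply: (not_ab p) => //; rewrite (eq_r p) // -(eq_r q).
Qed.

(** * The codegree graph *)

Lemma connect_cod_graph (gT : finGroupType) (G : {group gT}) (N : {set gT})
    (x y : cod_vertex G N) i :
    i \in Irr_over G N -> (ssval x %| codegree 'chi_i)%N ->
  (ssval y %| codegree 'chi_i)%N -> connect (cod_graph G N) x y.
Proof.
move=> Ni xi yi; have [-> | ne_xy] := eqVneq x y; first exact: connect0.
have [pr_x _] := mem_cod_primes G N _ (ssvalP x).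
have [pr_y _] := mem_cod_primes G N _ (ssvalP y).
apply: connect1; rewrite /cod_graph ne_xy; apply/existsP; exists i.
rewrite Ni Gauss_dvd ?xi // prime_coprime // dvdn_prime2 //.
Qed.

(** The set of prime divisors of b is closed under adjacency: a linear character
    contributes only primes of #|G : G^`(1)|, and a nonlinear one with codegree
    a only primes of a. *)
Lemma cod_graph_separated (gT : finGroupType) (G : {group gT}) a b
    (x y : cod_vertex G G) :
    coprime a b -> coprime b #|G : G^`(1)%g| ->
    (forall k : Iirr G, ~~ (G^`(1)%g \subset cfker 'chi_k) ->
       codegree 'chi_k \in [:: a; b]) ->
  (ssval x %| a)%N -> (ssval y %| b)%N -> ~~ connect (cod_graph G G) x y.
Proof.
move=> co_ab co_b codG xa yb.
have not_co (z : cod_vertex G G) m n :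
    coprime m n -> (ssval z %| m)%N -> (ssval z %| n)%N -> False.
  have [pr_z _] := mem_cod_primes G G _ (ssvalP z).
  move=> /eqP co_mn zm zn; have: (ssval z %| gcdn m n)%N by rewrite dvdn_gcd zm.
  by rewrite co_mn dvdn1 => /eqP z1; rewrite z1 in pr_z.
have step (z t : cod_vertex G G) i : (ssval z %| codegree 'chi[G]_i)%N ->
  (ssval t %| codegree 'chi_i)%N -> (ssval z %| b)%N -> (ssval t %| b)%N.
  move=> zi ti zb; have [G'i | nli] := boolP (G^`(1)%g \subset cfker 'chi_i).
    by case: (not_co z _ _ co_b zb); apply: dvdn_trans zi (codegree_lin_dvd G'i).
  have:= codG i nli; rewrite !inE => /orP[]/eqP Di; rewrite Di in zi ti => //.
  by case: (not_co z _ _ co_ab zi zb).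
have clb: closed (cod_graph G G) [pred z : cod_vertex G G | ssval z %| b]%N.
  move=> z t /andP[_ /existsP[i /andP[_ zti]]]; rewrite !inE.
  have [zi ti] := (dvdn_trans (dvdn_mulr _ (dvdnn _)) zti,
                   dvdn_trans (dvdn_mull _ (dvdnn _)) zti).
  by apply/idP/idP; apply: step; eassumption.
apply/negP=> /(closed_connect clb); rewrite !inE yb => xb.
exact: not_co co_ab xa xb.
Qed.

Local Open Scope nat_scope.

Theorem mainTheorem2 (gT : finGroupType) (G : {group gT}) :
  disconnected (cod_graph G G^`(1)%g) ->
  size (cod G G^`(1)%g) = 2 ->
  disconnected (cod_graph G G).
Proof.
move=> [u [v not_uv]] size_cod.
have [pr_u [i nli ui]] := mem_cod_primes G _ _ (ssvalP u).
have [pr_v [j nlj vj]] := mem_cod_primes G _ _ (ssvalP v).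
set a := codegree 'chi_i in ui; set b := codegree 'chi_j in vj.
have ne_ab: a != b.
  apply: contraNneq not_uv => Dab; apply: connect_cod_graph nli ui _.
  by rewrite -/a Dab.
have codG k : k \in Irr_over G G^`(1)%g -> codegree 'chi_k \in [:: a; b].
  move=> nlk.
  have mem_cod l : l \in Irr_over G G^`(1)%g ->
    codegree 'chi_l \in cod G G^`(1)%g.
    by move=> nll; rewrite mem_undup; apply: image_f.
  have sub_ab: {subset [:: a; b] <= cod G G^`(1)%g}.
    by move=> c; rewrite !inE => /orP[]/eqP->; apply: mem_cod.
  have uniq_ab: uniq [:: a; b] by rewrite /= inE ne_ab.
  have [_ ->] := uniq_min_size uniq_ab sub_ab (eq_leq size_cod).
  exact: mem_cod.
have co_ab: coprime a b.
  rewrite coprime_has_primes ?codegree_gt0 //; apply: contra not_uv.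
  case/hasP=> s; rewrite /= !mem_primes => /and3P[pr_s _ sb] /and3P[_ _ sa].
  have Vs: s \in cod_primes G G^`(1)%g.
    by apply/mem_cod_primes; split=> //; exists i.
  apply: connect_trans (connect_cod_graph (y := SeqSub Vs) nli ui sa) _.
  exact: (connect_cod_graph (x := SeqSub Vs) nlj sb vj).
have gt1 c p : prime p -> (p %| c) -> 0 < c -> 1 < c.
  by move=> /prime_gt1 p1 /dvdn_leq le_pc /le_pc; apply: leq_trans.
have a1: 1 < a by apply: gt1 pr_u ui (codegree_gt0 i).
have b1: 1 < b by apply: gt1 pr_v vj (codegree_gt0 j).
have nabG: ~~ abelian G.
  by move: nli; rewrite inE; apply: contra => /derG1P->; apply: sub1G.
have{} codG k : ~~ (G^`(1)%g \subset cfker 'chi[G]_k) ->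
  codegree 'chi_k \in [:: a; b].
  by move=> nlk; apply: codG; rewrite inE.
have VG s k : prime s -> k \in Irr_over G G^`(1)%g -> s %| codegree 'chi_k ->
  s \in cod_primes G G.
  move=> pr_s; rewrite inE => nlk sk; apply/mem_cod_primes; split=> //.
  by exists k; rewrite // inE; apply: contra nlk; apply: subset_trans (der_sub 1 G).
pose x := SeqSub (VG _ i pr_u nli ui); pose y := SeqSub (VG _ j pr_v nlj vj).
case/orP: (coprime_codegree_index_der1 co_ab a1 b1 nabG codG) => co_d.
  exists y, x; apply: (cod_graph_separated (a := b) (b := a)) => // [|k nlk].
    by rewrite coprime_sym.
  by have:= codG k nlk; rewrite !inE orbC.
by exists x, y; apply: (cod_graph_separated co_ab).
Qed.
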